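(* Let $F$ be any unsatisfiable CNF formula on $n$ variables, and suppose that there is a Stabbing Planes ($\mathsf{SP}$) refutation of $F$ of size $s$ whose coefficients all have absolute value at most $c$. Then there is a Cutting Planes ($\mathsf{CP}$) refutation of $F$ of size $s(cn)^{\log s}$.
   Context: A CNF $F$ on variables $x_1,\dots,x_n$ is encoded as linear inequalities: $0\le x_i\le 1$ for each $i$, and for each clause $C=\bigvee_{i\in P}x_i\vee\bigvee_{i\in N}\neg x_i$ the inequality $\sum_{i\in P}x_i+\sum_{i\in N}(1-x_i)\ge 1$; refutations of $F$ are refutations of this system. Cutting Planes: a proof is a sequence of integer linear inequalities, each from the system or derived from earlier ones by nonnegative integer linear combination of two earlier inequalities, or by division (from $ax\le b$ with a positive integer $d$ dividing all entries of $a$, deduce $(a/d)x\le\lfloor b/d\rfloor$); a refutation derives $0\ge1$; size = number of lines. Stabbing Planes: a refutation is a binary tree; each internal node is labelled by a query $(ax\le b-1, ax\ge b)$ with $a\in\mathbb{Z}^n,b\in\mathbb{Z}$ whose two outgoing edges carry these two inequalities; each leaf is labelled by a nonnegative linear combination of the input inequalities and the inequalities on its root path yielding $0\ge 1$. Size is the number of queries/nodes of the tree; coefficient size is the maximum absolute value of a coefficient in the queries. Logarithms are base 2.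
   Formalization: Proved for n ≥ 1, c ≥ 1 and s > 1, where s counts all nodes of the SP tree including leaves; for s = 1 the bound of one line fails (e.g. x₁ ∧ ¬x₁), and for s > 1 with c = 0 or n = 0 the bound is 0. *)

(* Defs.v *)
From mathcomp Require Import all_boot all_order all_algebra.
From mathcomp Require Import all_classical all_reals all_analysis.

Set Implicit Arguments.
Unset Strict Implicit.
Unset Printing Implicit Defensive.

Import Order.TTheory GRing.Theory Num.Theory.

Local Open Scope ring_scope.

(* (P, N) is the clause \/_(i in P) x_i \/ \/_(i in N) ~ x_i. *)
Definition clause (n : nat) : Type := ({set 'I_n} * {set 'I_n})%type.

Definition cnf (n : nat) : Type := seq (clause n).

Definition clause_sat (n : nat) (v : 'I_n -> bool) (C : clause n) : bool :=
  [exists i in C.1, v i] || [exists i in C.2, ~~ v i].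

Definition cnf_unsat (n : nat) (F : cnf n) : Prop :=
  forall v : 'I_n -> bool, ~~ all (clause_sat v) F.

(* The pair (a, b) is the inequality a x <= b; an inequality a x >= b is
   represented as (- a, - b).  The type is a product of Z-modules, with the
   componentwise sum and multiplication by natural numbers. *)
Definition ineq (n : nat) : Type := ('rV[int]_n * int)%type.

(* 0 >= 1 *)
Definition contradiction (n : nat) : ineq n := (0, -1).

(* \sum_(i in P) x_i + \sum_(i in N) (1 - x_i) >= 1, rewritten as
   \sum_(i in N) x_i - \sum_(i in P) x_i <= #|N| - 1. *)
Definition clause_ineq (n : nat) (C : clause n) : ineq n :=
  (\row_i ((i \in C.2)%:Z - (i \in C.1)%:Z), #|C.2|%:Z - 1).

Definition cnf_system (n : nat) (F : cnf n) : seq (ineq n) :=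
  [seq clause_ineq C | C <- F]
  ++ [seq (delta_mx 0 i, 1) | i <- enum 'I_n]
  ++ [seq (- delta_mx 0 i, 0) | i <- enum 'I_n].

(* In the division rule d > 0, so that (b %/ d)%Z is the floor of b / d. *)
Inductive cp_step (n : nat) (S pi : seq (ineq n)) : ineq n -> Prop :=
| cp_axiom l : l \in S -> cp_step S pi l
| cp_comb (k1 k2 : nat) l1 l2 :
    l1 \in pi -> l2 \in pi -> cp_step S pi (l1 *+ k1 + l2 *+ k2)
| cp_div (d : int) (a : 'rV[int]_n) (b : int) :
    0 < d -> (a, b) \in pi -> (forall i, (d %| a ord0 i)%Z) ->
    cp_step S pi (\row_i (a ord0 i %/ d)%Z, (b %/ d)%Z).

Inductive cp_proof (n : nat) (S : seq (ineq n)) : seq (ineq n) -> Prop :=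
| cp_nil : cp_proof S [::]
| cp_rcons pi l : cp_proof S pi -> cp_step S pi l -> cp_proof S (rcons pi l).

Definition cp_refutation (n : nat) (F : cnf n) (pi : seq (ineq n)) : Prop :=
  cp_proof (cnf_system F) pi /\ contradiction n \in pi.

(* A leaf carries the list of the inequalities it combines, each one with
   its coefficient. In SPQuery a b t1 t2, the edge to t1 carries
   a x <= b - 1 and the edge to t2 carries a x >= b. *)
Inductive sp_tree (R : realType) (n : nat) : Type :=
| SPLeaf of seq (R * ineq n)
| SPQuery of 'rV[int]_n & int & sp_tree R n & sp_tree R n.

Definition conic_contradiction (R : realType) (n : nat) (H : seq (ineq n))
    (w : seq (R * ineq n)) : Prop :=
  [/\ forall p, p \in w -> 0 <= p.1 /\ p.2 \in H,
      \sum_(p <- w) p.1 *: map_mx (intr : int -> R) p.2.1 = 0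
    & \sum_(p <- w) p.1 * (p.2.2)%:~R = -1].

Fixpoint sp_valid (R : realType) (n : nat) (H : seq (ineq n))
    (t : sp_tree R n) : Prop :=
  match t with
  | SPLeaf w => conic_contradiction H w
  | SPQuery a b t1 t2 =>
      sp_valid ((a, b - 1) :: H) t1 /\ sp_valid ((- a, - b) :: H) t2
  end.

Definition sp_refutation (R : realType) (n : nat) (F : cnf n)
    (t : sp_tree R n) : Prop :=
  sp_valid (cnf_system F) t.

(* Leaves are counted. *)
Fixpoint sp_size (R : realType) (n : nat) (t : sp_tree R n) : nat :=
  match t with
  | SPLeaf _ => 1
  | SPQuery _ _ t1 t2 => (sp_size t1 + sp_size t2).+1
  end.

(* The coefficients of the query (a x <= b - 1, a x >= b) are the entries of
   a; the right-hand side b is not bounded. *)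
Fixpoint sp_coef_le (R : realType) (n : nat) (c : nat)
    (t : sp_tree R n) : Prop :=
  match t with
  | SPLeaf _ => True
  | SPQuery a _ t1 t2 =>
      [/\ forall i, (`|a ord0 i| <= c)%N, sp_coef_le c t1 & sp_coef_le c t2]
  end.

Definition log2 (R : realType) (x : R) : R := ln x / ln 2.

(* Main.v *)
(* At a query (a x <= b - 1, a x >= b), take the side with the smaller subtree,
   say a x >= b, and sweep the hyperplane a x = t from the maximum of a x over
   the cube down to t = b: on each of these at most cn faces the smaller
   refutation applies, and a Cutting Planes refutation of the face lifts to a
   derivation of a x <= t - 1.  Then a x <= b - 1 is available for the larger
   subtree.  Hence f(s1 + s2 + 1) <= cn f(s1) + f(s2) + O(cn) with 2 s1 < s,
   which s (cn)^(log s) satisfies.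
   The bound has no hidden constant, so leaves need care: by Caratheodory a leaf
   combines at most n + 1 inequalities, and a query with a leaf child is not
   sliced, since the leaf yields the cut in one division.  A single query then
   costs 4n + 1 <= 3 n^(log 3) lines for n >= 2, and n = 1 is direct. *)

Require Import Defs.
From mathcomp Require Import all_boot all_order all_algebra.
From mathcomp Require Import all_classical all_reals all_analysis.
From mathcomp Require Import zify ring lra.

Set Implicit Arguments.
Unset Strict Implicit.
Unset Printing Implicit Defensive.

Import Order.TTheory GRing.Theory Num.Theory.

Local Open Scope ring_scope.

(** * Operations on Cutting Planes proofs: cut, linear combination, lifting from a face *)

Lemma ineq_mulrn n (p : ineq n) (m : nat) : p *+ m = (p.1 *+ m, p.2 *+ m).
Proof.
by elim: m => [|m IHm]; rewrite ?mulr0n // !mulrS IHm.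
Qed.

Lemma ineq_sum n (I : Type) (r : seq I) (h : I -> ineq n) (k : I -> nat) :
  \sum_(i <- r) h i *+ k i
  = (\sum_(i <- r) (h i).1 *+ k i, \sum_(i <- r) (h i).2 *+ k i).
Proof. by elim/big_rec3: _ => // i x y z _ ->; rewrite ineq_mulrn. Qed.

(** Once [p1] has derived [l], its copies in [p2] can be deleted; the line saved makes the bound
    strict. If [l] is no line of [p2], it never served as an axiom there. *)
Lemma cp_proof_cut n (S p1 p2 : seq (ineq n)) l :
  cp_proof S p1 -> l \in p1 -> cp_proof (l :: S) p2 ->
  exists p, [/\ cp_proof S p, {subset p2 <= p} & (size p < size p1 + size p2)%N].
Proof.
move=> h1 l1 h2; have p1_gt0 : (0 < size p1)%N by case: (p1) l1.
have [lp2|lp2] := boolP (l \in p2); last first.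
  exists p2; split=> //; last by lia.
  elim: h2 lp2 => [|pi l' _ IH st]; first by constructor.
  rewrite mem_rcons inE negb_or => /andP[ll' /IH h]; apply: cp_rcons => //.
  case: st ll' => [k kS|k1 k2 x1 x2 x1p x2p|d a b d0 abp dv] ll'.
  - by move: kS; rewrite inE eq_sym (negbTE ll') => kS; apply: cp_axiom.
  - exact: cp_comb.
  - exact: cp_div.
exists (p1 ++ [seq x <- p2 | x != l]); split.
- elim: h2 {lp2} => [|pi l' _ IH st]; first by rewrite cats0.
  rewrite filter_rcons; case: eqP => //= /eqP ll'.
  rewrite -rcons_cat; apply: cp_rcons => //.
  have sub : {subset pi <= p1 ++ [seq x <- pi | x != l]}.
    move=> x xpi; rewrite mem_cat mem_filter xpi andbT.
    by have [->|//] := eqVneq x l; rewrite ?l1 // orbT.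
  case: st ll' => [k kS|k1 k2 x1 x2 /sub x1p /sub x2p|d a b d0 /sub abp dv] ll'.
  - by move: kS; rewrite inE (negbTE ll') => kS; apply: cp_axiom.
  - exact: cp_comb.
  - exact: cp_div.
- move=> x xp; rewrite mem_cat mem_filter xp andbT.
  by have [->|//] := eqVneq x l; rewrite ?l1 // orbT.
- rewrite size_cat ltn_add2l size_filter -(count_predC (pred1 l) p2).
  rewrite -[ltnLHS]add0n ltn_add2r -has_count; apply/hasP; by exists l => //=.
Qed.

(** For [m >= 2] terms, count [m] axioms and [m - 1] additions. Shorter sums still take two lines,
    and [l0] supplies the premises of the empty one. *)
Lemma cp_comb_seq n (S : seq (ineq n)) l0 (w : seq (nat * ineq n)) :
  l0 \in S -> (forall p, p \in w -> p.2 \in S) ->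
  exists pi, [/\ cp_proof S pi, \sum_(p <- w) p.2 *+ p.1 \in pi
    & (size pi <= maxn 2 (2 * size w - 1))%N].
Proof.
move=> l0S; case: w => [|[k1 l1] [|[k2 l2] w]] wS.
- exists [:: l0; l0 *+ 0 + l0 *+ 0]; split=> //.
    apply: (@cp_rcons _ _ [:: l0]); last by apply: cp_comb; rewrite inE.
    by apply: (@cp_rcons _ _ [::]); [constructor|exact: cp_axiom].
  by rewrite big_nil !inE !mulr0n addr0 eqxx orbT.
- have l1S : l1 \in S by apply: (wS (k1, l1)); rewrite inE.
  exists [:: l1; l1 *+ k1 + l1 *+ 0]; split=> //.
    apply: (@cp_rcons _ _ [:: l1]); last by apply: cp_comb; rewrite inE.
    by apply: (@cp_rcons _ _ [::]); [constructor|exact: cp_axiom].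
  by rewrite big_seq1 !inE !mulr0n addr0 eqxx orbT.
- have -> : maxn 2 (2 * size [:: (k1, l1), (k2, l2) & w] - 1)
            = (3 + 2 * size w)%N by rewrite /=; lia.
  elim/last_ind: w wS => [|w [k l] IH] wS.
    have l1S : l1 \in S by apply: (wS (k1, l1)); rewrite inE eqxx.
    have l2S : l2 \in S by apply: (wS (k2, l2)); rewrite !inE eqxx orbT.
    exists [:: l1; l2; l1 *+ k1 + l2 *+ k2]; split=> //.
      apply: (@cp_rcons _ _ [:: l1; l2]); last first.
        by apply: cp_comb; rewrite !inE eqxx ?orbT.
      apply: (@cp_rcons _ _ [:: l1]); last exact: cp_axiom.
      by apply: (@cp_rcons _ _ [::]); [constructor|exact: cp_axiom].
    by rewrite big_cons big_seq1 !inE eqxx !orbT.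
  have [|pi [pf sm sz]] := IH.
    move=> p pw; apply: wS; move: pw; rewrite !inE mem_rcons inE.
    by case/or3P=> ->; rewrite ?orbT.
  have lS : l \in S by apply: (wS (k, l)); rewrite !inE mem_rcons inE eqxx !orbT.
  set s := (\sum_(p <- _) _) in sm.
  exists (rcons (rcons pi l) (s *+ 1 + l *+ k)); split.
  - apply: cp_rcons; first by apply: cp_rcons => //; exact: cp_axiom.
    by apply: cp_comb; rewrite mem_rcons inE ?eqxx ?sm ?orbT.
  - rewrite -2!rcons_cons big_rcons /= -/s addrC.
    by rewrite mem_rcons inE eqxx.
  - by rewrite !size_rcons; lia.
Qed.

(* [u] is an upper bound [a x <= t] and [- u] the face [a x = t] of it.  A line
   [l] derived on the face becomes [l + k u]; taking [k] divisible by the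
   product of the divisors still to come keeps every division applicable. *)
Lemma cp_proof_lift n (S pi : seq (ineq n)) u (M : nat) :
  u \in S -> cp_proof (- u :: S) pi -> (0 < M)%N ->
  exists pi', [/\ cp_proof S pi', u \in pi', size pi' = (size pi).+1 &
    forall l, l \in pi -> exists2 k : nat, (M %| k)%N & l + u *+ k \in pi'].
Proof.
move=> uS h; elim: h M => [|{}pi l _ IH st] M M0.
  exists [:: u]; rewrite inE eqxx; split=> //.
  by apply: (@cp_rcons _ _ [::]); [constructor|exact: cp_axiom].
suff [pi' [d [pf up sz d0 [h [k Mk st']]]]] : exists pi' (d : nat),
    [/\ cp_proof S pi', u \in pi', size pi' = (size pi).+1, (0 < d)%N &
    (forall l, l \in pi -> exists2 k : nat, (M * d %| k)%N & l + u *+ k \in pi')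
    /\ exists2 k : nat, (M %| k)%N & cp_step S pi' (l + u *+ k)].
  exists (rcons pi' (l + u *+ k)); split.
  - exact: cp_rcons.
  - by rewrite mem_rcons inE up orbT.
  - by rewrite !size_rcons sz.
  - move=> l'; rewrite mem_rcons inE => /orP[/eqP->|/h[k' Mk' h']].
      by exists k => //; rewrite mem_rcons inE eqxx.
    exists k'; first exact: dvdn_trans (dvdn_mulr _ _) Mk'.
    by rewrite mem_rcons inE h' orbT.
case: st => [{}l lS|k1 k2 l1 l2 l1p l2p|d a b d0 abp dv].
- move: lS; rewrite inE => lS; have [pi' [pf up sz h]] := IH _ M0.
  exists pi', 1%N; rewrite muln1; split=> //; split=> //.
  case/predU1P: lS => [->|lS]; last first.
    by exists 0 => //; rewrite mulr0n addr0; apply: cp_axiom.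
  (* The axiom [- u] lifts to [(M - 1) u], which follows from [u] alone. *)
  exists M => //; have -> : - u + u *+ M = u *+ M.-1 + u *+ 0.
    by rewrite -{1}(prednK M0) mulrS addKr mulr0n addr0.
  exact: cp_comb.
- have [pi' [pf up sz h]] := IH _ M0.
  exists pi', 1%N; rewrite muln1; split=> //; split=> //.
  have [q1 Mq1 h1] := h _ l1p; have [q2 Mq2 h2] := h _ l2p.
  exists (q1 * k1 + q2 * k2)%N; first by rewrite dvdn_add // dvdn_mulr.
  rewrite mulrnDr !mulrnA addrACA -!mulrnDl; exact: cp_comb.
- case: d d0 dv => // d d0 dv.
  have [|pi' [pf up sz h]] := IH (M * d)%N; first by rewrite muln_gt0 M0.
  exists pi', d; split=> //; split=> //.
  have [k /dvdnP[q ->] hk] := h _ abp.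
  exists (q * M)%N; first exact: dvdn_mull.
  have dz : (d : int) != 0 by rewrite lt0r_neq0.
  have E : (a, b) + u *+ (q * (M * d))
      = (a + u.1 *+ (q * (M * d)), b + u.2 *+ (q * (M * d))) :> ineq n.
    by rewrite ineq_mulrn.
  rewrite {}E in hk.
  have qMdE (x : int) : x *+ (q * (M * d)) = x *+ (q * M) * d%:Z.
    by rewrite mulnA mulrnA -[LHS]mulr_natr natz.
  have -> : (\row_i (a ord0 i %/ d)%Z, (b %/ d)%Z) + u *+ (q * M) =
      (\row_i ((a + u.1 *+ (q * (M * d))) ord0 i %/ d)%Z,
       ((b + u.2 *+ (q * (M * d))) %/ d)%Z) :> ineq n.
    have D x y : ((x + y *+ (q * (M * d))) %/ d)%Z
               = (x %/ d)%Z + y *+ (q * M).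
      by rewrite qMdE addrC divzMDl // addrC.
    rewrite D ineq_mulrn; congr pair.
    by apply/rowP=> i; rewrite !mxE !mulmxnE D.
  apply: cp_div => // i.
  by rewrite !mxE mulmxnE qMdE rpredD // dvdz_mull.
Qed.

(** * Caratheodory reduction and integral coefficients *)

(** While the rows are dependent, subtract a multiple of a linear relation until a first coefficient
    reaches 0, and drop its row. *)
Lemma conic_caratheodory (R : realFieldType) d m (A : 'M[R]_(m, d))
    (lam : 'rV_m) :
  (forall i, 0 <= lam ord0 i) ->
  exists m' (f : 'I_m' -> 'I_m) (lam' : 'rV_m'),
    [/\ row_free (rowsub f A), forall i, 0 <= lam' ord0 i
      & lam' *m rowsub f A = lam *m A].
Proof.
elim: m A lam => [|m IH] A lam lam0.
  exists 0, id, lam; split=> //; last by congr mulmx; apply/matrixP=> -[].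
  by rewrite /row_free -leqn0 rank_leq_row.
have [fA|nfA] := boolP (row_free A).
  by exists m.+1, id, lam; rewrite [rowsub id A](_ : _ = A) //;
    apply/matrixP=> i j; rewrite !mxE.
have [mu muA [i1 mu1]] : exists2 mu : 'rV_m.+1, mu *m A = 0
    & exists i, 0 < mu ord0 i.
  have /rowV0Pn[mu muA mun0] : kermx A != 0 by rewrite kermx_eq0.
  have {}muA : mu *m A = 0 by apply/sub_kermxP.
  have /rV0Pn[i mui] := mun0.
  have [mui0|mui0] := ltP 0 (mu ord0 i); first by exists mu => //; exists i.
  exists (- mu); first by rewrite mulNmx muA oppr0.
  by exists i; rewrite mxE oppr_gt0 lt_neqAle mui mui0.
(* The minimal ratio is the largest step that keeps every coefficient nonnegative. *)
have [i0 mu0 i0min] := @arg_minP _ _ _ i1 (fun i => 0 < mu ord0 i)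
  (fun i => lam ord0 i / mu ord0 i) mu1.
pose lam2 := lam - (lam ord0 i0 / mu ord0 i0) *: mu.
have lam2A : lam2 *m A = lam *m A.
  by rewrite mulmxBl -scalemxAl muA scaler0 subr0.
have lam2i0 : lam2 ord0 i0 = 0.
  by rewrite !mxE divfK ?subrr ?gt_eqF.
have lam20 i : 0 <= lam2 ord0 i.
  rewrite !mxE subr_ge0; have [mui|mui] := ltP 0 (mu ord0 i).
    by rewrite -ler_pdivlMr // i0min.
  apply: le_trans (lam0 i); apply: mulr_ge0_le0 => //.
  by rewrite divr_ge0 // ltW.
have [i|m' [f [lam' [ff l0 lE]]]] :=
  IH (rowsub (lift i0) A) (colsub (lift i0) lam2).
  by rewrite mxE.
exists m', (lift i0 \o f), lam'.
have -> : rowsub (lift i0 \o f) A = rowsub f (rowsub (lift i0) A).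
  by apply/matrixP=> i j; rewrite !mxE.
split=> //; rewrite lE -lam2A !mulmx_sum_row (bigD1_ord i0) //= lam2i0 scale0r.
rewrite add0r; apply: eq_bigr => i _; rewrite mxE; congr (_ *: _).
by apply/rowP=> j; rewrite !mxE.
Qed.

(** A system with integer entries that is solvable over [R] is solvable over [rat]. Row freeness
    makes the solution unique, so the rational one inherits nonnegativity from [lam]; then clear
    denominators. *)
Lemma row_free_int_solution (R : realFieldType) m d (A : 'M[int]_(m, d))
    (e : 'rV[int]_d) (lam : 'rV[R]_m) :
  row_free (map_mx intr A : 'M[R]_(m, d)) -> (forall i, 0 <= lam ord0 i) ->
  lam *m map_mx intr A = map_mx intr e ->
  exists (K : nat) (k : 'I_m -> nat), (0 < K)%N /\
    \sum_i row i A *+ k i = e *+ K.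
Proof.
move=> fA lam0 lamA.
have mapE p q (M : 'M[int]_(p, q)) :
    map_mx intr M = map_mx (ratr : rat -> R) (map_mx intr M).
  by apply/matrixP=> i j; rewrite !mxE ratr_int.
rewrite !mapE in fA lamA.
have /submxP[D eD] : (map_mx intr e <= (map_mx intr A : 'M[rat]_(m, d)))%MS.
  by rewrite -(map_submx (ratr : rat -> R)) -lamA submxMl.
have lamD : lam = map_mx ratr D.
  by apply: (row_free_inj fA); rewrite lamA eD map_mxM.
have D0 i : 0 <= D ord0 i by have := lam0 i; rewrite lamD mxE ler0q.
pose K := (\prod_i `|denq (D ord0 i)|)%N.
pose k i := (`|numq (D ord0 i)| * (K %/ `|denq (D ord0 i)|))%N.
have kE i : D ord0 i * K%:R = (k i)%:R.
  have dK : (`|denq (D ord0 i)| %| K)%N by rewrite /K (bigD1 i) //= dvdn_mulr.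
  have nE : `|numq (D ord0 i)|%:R = (numq (D ord0 i))%:~R :> rat.
    by rewrite -[LHS]/((Posz _)%:~R) gez0_abs // numq_ge0.
  have dE : `|denq (D ord0 i)|%:R = (denq (D ord0 i))%:~R :> rat.
    by rewrite -[LHS]/((Posz _)%:~R) absz_denq.
  have xd : D ord0 i * (denq (D ord0 i))%:~R = (numq (D ord0 i))%:~R.
    by rewrite -{1}[D ord0 i]divq_num_den divfK // intr_eq0 denq_neq0.
  by rewrite /k natrM -[in LHS](divnK dK) natrM mulrCA mulrC nE dE xd.
exists K, k; split.
  by rewrite prodn_gt0 // => i; rewrite absz_gt0 denq_neq0.
have inj (x y : 'rV[int]_d) :
    map_mx (intr : int -> rat) x = map_mx intr y -> x = y.
  by move/rowP=> xy; apply/rowP=> j; have := xy j; rewrite !mxE => /intr_inj.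
apply: inj.
have mapMn q (M : 'rV[int]_q) p :
    map_mx (intr : int -> rat) (M *+ p) = p%:R *: map_mx intr M.
  by apply/rowP=> j; rewrite !mxE mulmxnE rmorphMn /= mulr_natl.
rewrite mapMn eD scalemxAl mulmx_sum_row raddf_sum; apply: eq_bigr => i _.
by rewrite /= mapMn map_row !mxE mulrC kE.
Qed.

(* Caratheodory: a family of inequalities whose coefficient vectors, extended
   by the right-hand sides, are linearly independent has at most n+1 members,
   and the coefficients of the combination are then rational. *)
Lemma conic_contradiction_nat (R : realType) n (H : seq (ineq n))
    (w : seq (R * ineq n)) :
  conic_contradiction H w ->
  exists m (h : 'I_m -> ineq n) (k : 'I_m -> nat) (K : nat),
    [/\ (m <= n.+1)%N, injective h, forall i, h i \in H, (0 < K)%N &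
      \sum_i h i *+ k i = (0, - K%:Z)].
Proof.
case=> wH w1 w2.
pose wi (i : 'I_(size w)) := tnth (in_tuple w) i.
have wiw i : wi i \in w by apply: mem_tnth.
pose A : 'M[int]_(size w, n + 1) :=
  \matrix_i row_mx (wi i).2.1 (\row_(j < 1) (wi i).2.2).
pose lam : 'rV[R]_(size w) := \row_i (wi i).1.
have lam0 i : 0 <= lam ord0 i by rewrite mxE; have [] := wH _ (wiw i).
have [m [f [lam' [ff lam'0 lam'E]]]] := conic_caratheodory (map_mx intr A) lam0.
pose e : 'rV[int]_(n + 1) := row_mx 0 (\row_(j < 1) -1).
pose B := rowsub f A.
have mapB : rowsub f (map_mx intr A) = map_mx intr B :> 'M[R]_(m, _).
  by apply/matrixP=> i j; rewrite !mxE.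
have lamA : lam *m map_mx intr A = map_mx intr e.
  rewrite mulmx_sum_row /e map_row_mx map_mx0 -w1.
  have -> : map_mx intr (\row_(j < 1) -1) =
      \sum_(p <- w) p.1 *: (\row_(j < 1) (p.2.2%:~R : R)).
    apply/rowP=> j; rewrite !mxE summxE -[LHS]w2.
    by apply: eq_bigr => p _; rewrite !mxE.
  rewrite !(big_tnth _ _ w) -/wi.
  transitivity (\sum_i (wi i).1 *: row_mx (map_mx intr (wi i).2.1)
     (\row_(j < 1) ((wi i).2.2%:~R : R))).
    apply: eq_bigr => i _; rewrite mxE; congr (_ *: _).
    rewrite -map_row rowK map_row_mx; congr row_mx.
    by apply/rowP=> j; rewrite !mxE.
  apply/rowP=> j; rewrite summxE mxE; case: splitP => j' jj'.
    have -> : j = lshift 1 j' by apply: val_inj.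
    rewrite summxE; apply: eq_bigr => i _.
    by rewrite [LHS]mxE row_mxEl !mxE.
  have -> : j = rshift n j' by apply: val_inj.
  rewrite summxE; apply: eq_bigr => i _.
  by rewrite [LHS]mxE row_mxEr !mxE.
rewrite mapB in ff lam'E; rewrite lamA in lam'E.
have [K [k [K0 kE]]] := row_free_int_solution ff lam'0 lam'E.
pose h i := (wi (f i)).2.
exists m, h, k, K; split=> //.
- by rewrite -addn1 -[m](eqP ff) rank_leq_col.
(* Independence forbids repetitions, so a query inequality occurs at most once among the [h i]. *)
- move=> i j hij; have rij : row i B = row j B.
    by apply/rowP=> l; rewrite !mxE -/(h i) hij.
  have : delta_mx 0 i *m map_mx intr B = delta_mx 0 j *m map_mx intr B :> 'rV[R]_(_).
    by rewrite -!rowE -!map_row rij.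
  move/(row_free_inj ff)/rowP/(_ i); rewrite !mxE !eqxx /=.
  by case: eqP => // _ /eqP; rewrite oner_eq0.
- by move=> i; have [] := wH _ (wiw (f i)).
- have BE i : row i B = row_mx (h i).1 (\row_(j < 1) (h i).2).
    by apply/rowP=> j; rewrite !mxE.
  rewrite ineq_sum; congr pair.
    apply/rowP=> j; rewrite [RHS]mxE; move/rowP/(_ (lshift 1 j)): kE.
    rewrite [RHS]mulmxnE row_mxEl mxE mul0rn => <-.
    rewrite !summxE; apply: eq_bigr => i _.
    by rewrite !mulmxnE BE row_mxEl.
  move/rowP/(_ (rshift n ord0)): kE.
  rewrite [RHS]mulmxnE row_mxEr mxE mulNrn natz => <-.
  rewrite summxE; apply: eq_bigr => i _.
  by rewrite mulmxnE BE row_mxEr mxE.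
Qed.

(** * Refutable contexts and the leaves of the tree *)

Definition box n : seq (ineq n) :=
  [seq (delta_mx 0 i, 1) | i <- enum 'I_n]
  ++ [seq (- delta_mx 0 i, 0) | i <- enum 'I_n].

(* The contexts met during the simulation are only known up to a strengthening
   of right-hand sides. *)
Definition dominates n (S H : seq (ineq n)) : Prop :=
  forall h, h \in H -> exists2 l, l \in S & l.1 = h.1 /\ l.2 <= h.2.

(** Invariant of the simulation: [H] lists the inequalities of a root path, [S] those available to
    Cutting Planes. *)
Definition refutable n (N : nat) (H : seq (ineq n)) : Prop :=
  forall S, {subset box n <= S} -> dominates S H ->
  exists pi, [/\ cp_proof S pi, contradiction n \in pi & (size pi <= N)%N].

Lemma dominates_cons n (S H : seq (ineq n)) a b b' :
  dominates S H -> b' <= b -> dominates ((a, b') :: S) ((a, b) :: H).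
Proof.
move=> dSH bb h; rewrite inE => /predU1P[->|/dSH[l lS lh]].
  by exists (a, b'); rewrite ?inE ?eqxx.
by exists l; rewrite // inE lS orbT.
Qed.

Lemma dominates_consl n (S H : seq (ineq n)) l :
  dominates S H -> dominates (l :: S) H.
Proof.
by move=> dSH h /dSH[l' lS lh]; exists l'; rewrite // inE lS orbT.
Qed.

Lemma dominates_family n (S H : seq (ineq n)) (I : Type) (h : I -> ineq n) :
  dominates S H -> (forall i, h i \in H) ->
  exists g : I -> ineq n,
    [/\ forall i, g i \in S, forall i, (g i).1 = (h i).1
      & forall i, (g i).2 <= (h i).2].
Proof.
move=> dSH hH.
have /choice[g gP] i : exists l, l \in S /\ (l.1 = (h i).1 /\ l.2 <= (h i).2).
  by have [l lS lh] := dSH _ (hH i); exists l.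
exists g; split=> i; by have [? []] := gP i.
Qed.

(* The right-hand side can only decrease when each [h i] is replaced by a
   dominating inequality. *)
Lemma cp_sum n (S H : seq (ineq n)) m (h : 'I_m -> ineq n) (k : 'I_m -> nat) :
  (0 < n)%N -> {subset box n <= S} -> dominates S H ->
  (forall i, h i \in H) ->
  exists pi (b : int), [/\ cp_proof S pi, ((\sum_i h i *+ k i).1, b) \in pi,
    b <= (\sum_i h i *+ k i).2 & (size pi <= maxn 2 (2 * m - 1))%N].
Proof.
move=> n0 boxS dSH hH; have [g [gS g1 g2]] := dominates_family dSH hH.
have l0S : (delta_mx 0 (Ordinal n0), 1) \in S.
  by apply: boxS; rewrite mem_cat map_f ?mem_enum.
have [|pi [pf sm sz]] := @cp_comb_seq n S _ [seq (k i, g i) | i <- enum 'I_m] l0S.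
  by move=> _ /mapP[i _ ->]; apply: gS.
exists pi, (\sum_i g i *+ k i).2; split=> //.
- move: sm; rewrite big_map big_enum /= !ineq_sum /=.
  by under eq_bigr do rewrite g1.
- by rewrite !ineq_sum /=; apply: ler_sum => i _; rewrite lerMn2r g2 orbT.
- by move: sz; rewrite size_map size_enum_ord.
Qed.

Lemma cp_refute_sum n (S H : seq (ineq n)) m (h : 'I_m -> ineq n)
    (k : 'I_m -> nat) (K : nat) :
  (0 < n)%N -> (m <= n.+1)%N -> {subset box n <= S} -> dominates S H ->
  (forall i, h i \in H) -> (0 < K)%N -> \sum_i h i *+ k i = (0, - K%:Z) ->
  exists pi,
    [/\ cp_proof S pi, contradiction n \in pi & (size pi <= 2 * n + 2)%N].
Proof.
move=> n0 mn boxS dSH hH K0 hE.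
have [pi [b [pf sm bK sz]]] := cp_sum k n0 boxS dSH hH.
rewrite {}hE /= in sm bK.
have b0 : 0 < - b by lia.
(* The sum reads [0 <= b] with [b <= - K < 0]; dividing by [- b] normalizes it to [0 <= -1]. *)
exists (rcons pi (\row_i ((0 : 'rV[int]_n) ord0 i %/ - b)%Z, (b %/ - b)%Z)).
split.
- apply: cp_rcons => //; apply: cp_div => // i.
  by rewrite mxE dvdz0.
- rewrite mem_rcons inE; apply/orP; left; apply/eqP; congr pair.
    by apply/rowP=> i; rewrite !mxE div0z.
  by rewrite divzN divzz; case: eqVneq b0 => // ->; rewrite oppr0.
- by rewrite size_rcons; lia.
Qed.

Lemma refutable_leaf (R : realType) n (H : seq (ineq n)) (w : seq (R * ineq n)) :
  (0 < n)%N -> conic_contradiction H w -> refutable (2 * n + 2) H.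
Proof.
move=> n0 /conic_contradiction_nat[m [h [k [K [mn _ hH K0 hE]]]]] S boxS dSH.
exact: (cp_refute_sum n0 mn boxS dSH hH K0 hE).
Qed.

(* When the query has a leaf on the side [a x >= b], no slicing is needed:
   solving the combination at the leaf for [a x] yields [k a x < k b]. *)
Lemma refutable_leaf_query (R : realType) n (H : seq (ineq n)) (a : 'rV_n)
    (b : int) N (w : seq (R * ineq n)) :
  (1 < n)%N -> (2 < N)%N -> conic_contradiction ((- a, - b) :: H) w ->
  refutable N ((a, b - 1) :: H) -> refutable (2 * n + N - 1) H.
Proof.
move=> n1 N2 /conic_contradiction_nat[m [h [k [K [mn hI hH K0 hE]]]]] rN S.
have n0 : (0 < n)%N by apply: ltn_trans n1.
move=> boxS dSH; have [/existsP[i0 /eqP hi0]|/existsPn nh] :=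
  boolP [exists i, h i == (- a, - b)]; last first.
  have hH' i : h i \in H.
    by have := hH i; rewrite inE (negbTE (nh i)).
  have [pi [pf pc sz]] := cp_refute_sum n0 mn boxS dSH hH' K0 hE.
  by exists pi; split=> //; lia.
case: m mn h k hI hH hE i0 hi0 => [_ _ _ _ _ _ [] //|m mn h k hI hH hE i0 hi0].
have hH' i : (h \o lift i0) i \in H.
  have := hH (lift i0 i); rewrite inE -hi0 => /orP[/eqP/hI/eqP|//].
  by rewrite eq_sym (negbTE (neq_lift _ _)).
rewrite (bigD1_ord i0) //= hi0 in hE.
have [k0|k0] := posnP (k i0).
  rewrite k0 mulr0n add0r in hE.
  have [|pi [pf pc sz]] := cp_refute_sum n0 _ boxS dSH hH' K0 hE; first by lia.
  by exists pi; split=> //; lia.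
have {}hE : \sum_i (h \o lift i0) i *+ (k \o lift i0) i
    = (a *+ k i0, b *+ k i0 - K%:Z).
  move/(canRL (addKr _)): hE => /= ->.
  by rewrite ineq_mulrn /= !mulNrn; congr pair; rewrite /= opprK ?addr0.
have [pi [b' [pf sm bK sz]]] := cp_sum (k \o lift i0) n0 boxS dSH hH'.
rewrite {}hE /= in sm bK.
have kz : 0 < (k i0 : int) by [].
have akE i : (a *+ k i0) ord0 i = a ord0 i * (k i0 : int).
  by rewrite mulmxnE -[LHS]mulr_natr natz.
(* As [K > 0], [b'] is less than [k i0] times [b], so the rounded quotient is below [b]. *)
have b'b : (b' %/ k i0)%Z <= b - 1.
  have : (b' %/ k i0)%Z < b.
    by rewrite ltz_divLR //; move: bK; rewrite -mulr_natr natz; lia.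
  by lia.
have pf1 : cp_proof S (rcons pi (a, (b' %/ k i0)%Z)).
  apply: cp_rcons => //; have -> : a = \row_i ((a *+ k i0) ord0 i %/ k i0)%Z.
    by apply/rowP=> i; rewrite mxE akE mulzK // gt_eqF.
  by apply: cp_div => // i; rewrite akE dvdz_mull.
have [||pi2 [pf2 pc2 sz2]] := rN ((a, (b' %/ k i0)%Z) :: S).
- by move=> l /boxS lS; rewrite inE lS orbT.
- exact: dominates_cons.
have [|p [pfp sub szp]] := cp_proof_cut pf1 _ pf2.
  by rewrite mem_rcons inE eqxx.
exists p; split=> //; first exact: sub.
by move: szp; rewrite size_rcons; lia.
Qed.

(** * Slicing a query *)

(** Lifting [0 <= -1] from the face gives [k a x <= k t - 1], and division by [k] rounds this to
    [a x <= t - 1]. If [k = 0], the lifted line is already the contradiction. *)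
Lemma cp_face n (S pi : seq (ineq n)) (a : 'rV_n) (t : int) :
  (a, t) \in S -> cp_proof ((- a, - t) :: S) pi -> contradiction n \in pi ->
  exists pi', [/\ cp_proof S pi',
    (a, t - 1) \in pi' \/ contradiction n \in pi'
    & (size pi' <= (size pi).+2)%N].
Proof.
move=> uS pf pc.
have [pi' [pf' _ sz h]] := @cp_proof_lift _ _ _ (a, t) 1 uS pf isT.
have [[|k] _ hk] := h _ pc.
  rewrite mulr0n addr0 in hk.
  by exists pi'; split=> //; [right|rewrite sz].
exists (rcons pi' (a, t - 1)); split.
- apply: cp_rcons => //; rewrite ineq_mulrn in hk.
  have akE i : (0 + a *+ k.+1) ord0 i = a ord0 i * (k.+1 : int).
    by rewrite add0r mulmxnE -[LHS]mulr_natr natz.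
  have -> : a = \row_i ((0 + a *+ k.+1) ord0 i %/ k.+1)%Z.
    by apply/rowP=> i; rewrite mxE akE mulzK.
  have -> : t - 1 = ((- 1 + t *+ k.+1) %/ k.+1)%Z.
    by rewrite -[t *+ _]mulr_natr natz [-1 + _]addrC divzMDl.
  by apply: cp_div => // i; rewrite akE dvdz_mull.
- by left; rewrite mem_rcons inE eqxx.
- by rewrite size_rcons sz.
Qed.

(* Sweep the hyperplane [a x = t] down from an upper bound on [a x] to [b];
   each slice is a face, on which the refutation of [a x >= b] applies. *)
Lemma cp_slices n (H S : seq (ineq n)) (a : 'rV_n) (b : int) (N1 N2 W : nat) :
  refutable N1 ((- a, - b) :: H) -> refutable N2 ((a, b - 1) :: H) ->
  (0 < N2)%N -> {subset box n <= S} -> dominates S H ->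
  (a, b - 1 + W%:Z) \in S ->
  exists pi, [/\ cp_proof S pi, contradiction n \in pi
    & (size pi <= W * N1.+1 + N2)%N].
Proof.
move=> r1 r2 N20; elim: W S => [|W IH] S boxS dSH uS.
  rewrite addr0 in uS; apply: r2 => // h; rewrite inE => /predU1P[->|/dSH //].
  by exists (a, b - 1).
set t := b - 1 + _ in uS.
have [||pi [pf pc sz]] := r1 ((- a, - t) :: S).
- by move=> l /boxS lS; rewrite inE lS orbT.
- by apply: dominates_cons => //; rewrite /t; lia.
have [pi' [pf' [p1|pc'] sz']] := cp_face uS pf pc; last first.
  by exists pi'; split=> //; rewrite mulSn; lia.
have [|||p2 [pf2 pc2 sz2]] := IH ((a, t - 1) :: S).
- by move=> l /boxS lS; rewrite inE lS orbT.
- exact: dominates_consl.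
- by rewrite inE; apply/orP; left; rewrite /t; apply/eqP; congr pair; lia.
have [p [pfp sub szp]] := cp_proof_cut pf' p1 pf2.
by exists p; split=> //; [exact: sub|rewrite mulSn; lia].
Qed.

(** A nonnegative coefficient is matched with [x_i <= 1], a negative one with [- x_i <= 0], so the
    right-hand side is the maximum of [a x] on the cube. *)
Lemma cp_box_max n (S : seq (ineq n)) (a : 'rV[int]_n) :
  (1 < n)%N -> {subset box n <= S} ->
  exists pi, [/\ cp_proof S pi,
    (a, \sum_i Num.max (a ord0 i) 0) \in pi & (size pi < 2 * n)%N].
Proof.
move=> n1 boxS; pose l0 i : ineq n :=
  if 0 <= a ord0 i then (delta_mx 0 i, 1) else (- delta_mx 0 i, 0).
have l0S i : l0 i \in S.
  apply: boxS; rewrite /l0 mem_cat; case: ifP => _; apply/orP; [left|right];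
    by apply: map_f; rewrite mem_enum.
have [|pi [pf sm sz]] := @cp_comb_seq n S _
    [seq (`|a ord0 i|%N, l0 i) | i <- enum 'I_n] (l0S (Ordinal n1)).
  by move=> _ /mapP[i _ ->]; apply: l0S.
exists pi; split=> //; last by move: sz; rewrite size_map size_enum_ord; lia.
move: sm; rewrite big_map big_enum /= ineq_sum; set q := (q in q \in pi).
suff -> : q = (a, \sum_i Num.max (a ord0 i) 0) by [].
congr pair; last first.
  by apply: eq_bigr => i _; rewrite /l0; case: ifP => ai /=; lia.
rewrite [RHS]row_sum_delta; apply: eq_bigr => i _.
rewrite /l0; case: ifP => ai /=.
  by rewrite -scaler_nat natz gez0_abs.
by rewrite mulNrn -scaler_nat natz -scaleNr ltz0_abs ?opprK // ltNge ai.
Qed.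

Lemma refutable_query n (H : seq (ineq n)) (a : 'rV_n) (b : int) (c N1 N2 : nat) :
  (1 < n)%N -> (0 < c)%N -> (forall i, `|a ord0 i| <= c)%N ->
  (0 < N1)%N -> (0 < N2)%N ->
  refutable N1 ((- a, - b) :: H) -> refutable N2 ((a, b - 1) :: H) ->
  refutable (2 * n - 2 + c * n * N1.+1 + N2) H.
Proof.
move=> n1 c0 ac N10 N20 r1 r2 S boxS dSH.
have boxS' l : {subset box n <= l :: S}.
  by move=> x /boxS xS; rewrite inE xS orbT.
set t0 : int := \sum_i Num.max (a ord0 i) 0.
set t1 : int := \sum_i Num.max ((- a) ord0 i) 0.
have maxN (x : int) : Num.max x 0 + Num.max (- x) 0 = `|x|%N by lia.
(* On the cube [a x] lies between [- t1] and [t0], and [t0 + t1] is the sum of the [|a_i|]. *)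
have t01 : t0 + t1 <= (c * n)%N%:Z.
  rewrite /t0 /t1 -big_split /=.
  apply: (@le_trans _ _ (\sum_(i < n) c%:Z)).
    by apply: ler_sum => i _; rewrite mxE maxN lez_nat.
  by rewrite sumr_const card_ord; lia.
have [p0 [pf0 u0 sz0]] := cp_box_max a n1 boxS.
have [p1 [pf1 u1 sz1]] := cp_box_max (- a) n1 boxS.
have cn0 : (N1 <= c * n * N1.+1)%N.
  by apply: (@leq_trans (1 * N1.+1)); rewrite ?leq_mul //; lia.
have [bt0|bt0] := ltP t0 b.
  have [|q [pfq qc szq]] := r2 ((a, t0) :: S) (boxS' _).
    by apply: dominates_cons => //; lia.
  have [p [pfp sub szp]] := cp_proof_cut pf0 u0 pfq.
  by exists p; split=> //; [exact: sub|lia].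
(* If [b <= - t1], the whole cube satisfies [a x >= b], and [- a x <= t1] dominates that edge. *)
have [bt1|bt1] := leP b (- t1).
  have [|q [pfq qc szq]] := r1 ((- a, t1) :: S) (boxS' _).
    by apply: dominates_cons => //; lia.
  have [p [pfp sub szp]] := cp_proof_cut pf1 u1 pfq.
  by exists p; split=> //; [exact: sub|lia].
(* The slices are [t = t0, ..., b]; since [b > - t1], there are at most [t0 + t1 <= c n]. *)
pose W := `|(t0 - (b - 1))%R|%N.
have [|q [pfq qc szq]] := cp_slices (W := W) r1 r2 N20
    (boxS' (a, t0)) (dominates_consl _ dSH).
  by rewrite inE; apply/orP; left; apply/eqP; congr pair; rewrite /W; lia.
have [p [pfp sub szp]] := cp_proof_cut pf0 u0 pfq.
exists p; split=> //; first exact: sub.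
have WN : (W * N1.+1 <= c * n * N1.+1)%N by rewrite leq_mul //; lia.
by lia.
Qed.

(** * Estimates on the size bound [s x^(log s)] *)

Lemma powR_log2M (R : realType) (x s t : R) :
  0 < x -> 0 < s -> 0 < t ->
  x `^ log2 (s * t) = x `^ log2 s * x `^ log2 t.
Proof.
move=> x0 s0 t0; rewrite /log2 lnM ?posrE // mulrDl powRD //.
by apply/implyP => _; rewrite gt_eqF.
Qed.

(** Used with multiplicativity: doubling [s] multiplies [x^(log s)] by [x], the factor that pays for
    the slices. *)
Lemma powR_log2_2 (R : realType) (x : R) : 0 < x -> x `^ log2 2 = x.
Proof.
by move=> x0; rewrite /log2 divff ?powRr1 ?ltW // gt_eqF // ln_gt0 // ltr1n.
Qed.

Lemma ler_powR_log2 (R : realType) (x s t : R) :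
  1 <= x -> 0 < s -> s <= t -> x `^ log2 s <= x `^ log2 t.
Proof.
move=> x1 s0 st; apply: ler_powR => //; rewrite /log2 ler_pM2r.
  by rewrite ler_ln ?posrE // (lt_le_trans s0).
by rewrite invr_gt0 ln_gt0 // ltr1n.
Qed.

Lemma powR2_log2 (R : realType) (s : R) : 0 < s -> 2 `^ log2 s = s.
Proof.
move=> s0; rewrite /powR ifF; last by rewrite gt_eqF.
by rewrite /log2 divfK ?lnK ?posrE // gt_eqF // ln_gt0 // ltr1n.
Qed.

Lemma powR_log2_4 (R : realType) (x : R) : 0 < x -> x `^ log2 4 = x ^+ 2.
Proof.
move=> x0; have -> : 4 = 2 * 2 :> R by ring.
by rewrite powR_log2M // powR_log2_2.
Qed.

(* The case of a tree with a single query. Equality holds at [c n = 2]; for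
   [x >= 3] compare the squares, using [x^(log 9) >= x^(log 8) = x^3]. *)
Lemma powR_log2_3_ge (R : realType) (m : nat) :
  (1 < m)%N -> (4 * m + 1)%:R <= 3 * m%:R `^ log2 (3 : R).
Proof.
move=> m1; have [->|m2] := eqVneq m 2.
  by rewrite powR2_log2 // -natrM ler_nat.
have m3 : 3 <= m%:R :> R by rewrite ler_nat; lia.
set x : R := m%:R in m3 *; set y := x `^ _.
have x0 : 0 < x by lra.
have y0 : 0 <= y by apply: powR_ge0.
have yx : x ^+ 3 <= y ^+ 2.
  rewrite expr2 /y -powR_log2M // exprS -powR_log2_4 //.
  rewrite -{1}(powR_log2_2 x0) -powR_log2M //.
  by apply: ler_powR_log2 => //; lra.
have x23 : 3 * x ^+ 2 <= x ^+ 3.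
  by rewrite [leRHS]exprS ler_wpM2r // sqr_ge0.
rewrite natrD natrM -/x; apply: (@le_trans _ _ `|4 * x + 1|); first exact: ler_norm.
have xx : 3 * x <= x ^+ 2 by rewrite expr2 ler_wpM2r // ltW.
have y3 : `|3 * y| = 3 * y by rewrite ger0_norm // mulr_ge0.
by rewrite -y3 -ler_sqr ?nnegrE // !real_normK ?num_real //; lra.
Qed.

Lemma sp_size_gt0 (R : realType) n (T : sp_tree R n) : (0 < sp_size T)%N.
Proof. by case: T. Qed.

Lemma sp_size_le1 (R : realType) n (T : sp_tree R n) :
  (sp_size T <= 1)%N -> exists w, T = SPLeaf w.
Proof.
case: T => [w|a b t1 t2] /=; first by exists w.
by have := sp_size_gt0 t1; lia.
Qed.

Lemma sp_size_gt2 (R : realType) n (T : sp_tree R n) :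
  (1 < sp_size T)%N -> (2 < sp_size T)%N.
Proof.
case: T => //= a b t1 t2 _.
by have := sp_size_gt0 t1; have := sp_size_gt0 t2; lia.
Qed.

(** Put [s = s1 + s2 + 1] and [y = x^(log s)]. As [2 s1 < s], [x N1 <= s1 y]; also [N2 <= s2 y]. The
    remaining [y >= x^2] covers the overhead [2 n - 2 + x], at most [3 x - 2], because
    [(x - 1) (x - 2) >= 0]. *)
Lemma query_bound (R : realType) (c n s1 s2 N1 N2 : nat) (x := (c * n)%:R : R) :
  (1 < n)%N -> (0 < c)%N -> (2 < s1)%N -> (s1 <= s2)%N ->
  N1%:R <= s1%:R * x `^ log2 s1%:R -> N2%:R <= s2%:R * x `^ log2 s2%:R ->
  (2 * n - 2 + c * n * N1.+1 + N2)%:R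
    <= (s1 + s2).+1%:R * x `^ log2 (s1 + s2).+1%:R.
Proof.
move=> n1 c0 s1_gt2 s12 h1 h2.
have x2 : 2 <= x by rewrite ler_nat; nia.
have nx : n%:R <= x by rewrite ler_nat; nia.
set y := x `^ log2 (s1 + s2).+1%:R.
have x0 : 0 < x by lra.
have s1R : 3 <= s1%:R :> R by rewrite ler_nat.
have s12R : s1%:R <= s2%:R :> R by rewrite ler_nat.
have sE : (s1 + s2).+1%:R = s1%:R + s2%:R + 1 :> R by rewrite -natr1 natrD.
have y4 : x ^+ 2 <= y.
  by rewrite -powR_log2_4 //; apply: ler_powR_log2; rewrite ?sE; lra.
have y1 : x * x `^ log2 s1%:R <= y.
  rewrite -{1}(powR_log2_2 x0) -powR_log2M //; last by lra.
  by apply: ler_powR_log2; rewrite ?sE; lra.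
have y2 : x `^ log2 s2%:R <= y.
  by apply: ler_powR_log2; rewrite ?sE; lra.
rewrite natrD natrD natrM -/x natrB ?natrM; last by lia.
rewrite -natr1 sE.
have h1' : x * N1%:R <= s1%:R * y.
  apply: (le_trans (ler_wpM2l (ltW x0) h1)).
  by rewrite mulrCA ler_wpM2l.
have h2' : N2%:R <= s2%:R * y by apply: (le_trans h2); rewrite ler_wpM2l.
have xx : 3 * x <= x ^+ 2 + 2.
  have : 0 <= (x - 1) * (x - 2) by apply: mulr_ge0; lra.
  by lra.
by lra.
Qed.

(** With [y = x^(log (s + 2))], the two extra nodes contribute [2 y], and already
    [y >= x^2 >= 2 x >= 2 n]. *)
Lemma leaf_query_bound (R : realType) (c n s N : nat) (x := (c * n)%:R : R) :
  (1 < n)%N -> (0 < c)%N -> (2 < s)%N ->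
  N%:R <= s%:R * x `^ log2 s%:R ->
  (2 * n + N - 1)%:R <= s.+2%:R * x `^ log2 s.+2%:R.
Proof.
move=> n1 c0 s_gt2 h.
have x2 : 2 <= x by rewrite ler_nat; nia.
have nx : n%:R <= x by rewrite ler_nat; nia.
set y := x `^ log2 s.+2%:R.
have x0 : 0 < x by lra.
have sR : 3 <= s%:R :> R by rewrite ler_nat.
have sE : s.+2%:R = s%:R + 2 :> R by rewrite -2!natr1; ring.
have y4 : x ^+ 2 <= y.
  by rewrite -powR_log2_4 //; apply: ler_powR_log2; rewrite ?sE; lra.
have y2 : x `^ log2 s%:R <= y by apply: ler_powR_log2; rewrite ?sE; lra.
apply: (@le_trans _ _ (2 * n + N)%:R); first by rewrite ler_nat leq_subr.
rewrite natrD natrM sE.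
have h' : N%:R <= s%:R * y by apply: (le_trans h); rewrite ler_wpM2l.
have xx : 2 * x <= x ^+ 2 by rewrite expr2 ler_wpM2r // ltW.
by lra.
Qed.

(** * Induction on the tree *)

(** At size 1 the bound is 1, too small for the [2 n + 2] lines allotted to a leaf, so leaves are
    treated together with their parent query. [2 < N] serves the case of a leaf that does not use
    the query: [2 n + 2 <= 2 n + N - 1]. *)
Lemma refutable_sp (R : realType) n c (T : sp_tree R n) (H : seq (ineq n)) :
  (1 < n)%N -> (0 < c)%N -> sp_valid H T -> sp_coef_le c T ->
  (1 < sp_size T)%N ->
  exists N : nat, [/\ (2 < N)%N,
    N%:R <= (sp_size T)%:R * (c * n)%:R `^ log2 ((sp_size T)%:R : R)
    & refutable N H].
Proof.
move=> n1 c0; have n0 : (0 < n)%N by lia.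
elim: T H => // a b t1 IH1 t2 IH2 H [v1 v2] [ac c1 c2] _ /=.
(* Replacing [a], [b] by [- a], [1 - b] exchanges the sides of the query, so the one-sided lemmas
   apply to both. *)
have aE : - - a = a by rewrite opprK.
have bE : - (1 - b) = b - 1 by ring.
have bE' : 1 - b - 1 = - b by ring.
have [s1|s1] := leqP (sp_size t1) 1; have [s2|s2] := leqP (sp_size t2) 1.
- have [w1 t1E] := sp_size_le1 s1; have [w2 t2E] := sp_size_le1 s2.
  rewrite {}t1E {}t2E in v1 v2 *.
  exists (2 * n + (2 * n + 2) - 1)%N; split; first by lia.
    apply: (le_trans _ (le_trans (powR_log2_3_ge R (m := c * n) _) _)) => //.
    + by rewrite ler_nat; nia.
    + by nia.
  apply: (refutable_leaf_query (w := w2) (a := a) (b := b)) => //; first by lia.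
  exact: refutable_leaf v1.
- have [w1 t1E] := sp_size_le1 s1; rewrite {}t1E in v1 *.
  have [N [N2 NE r]] := IH2 _ v2 c2 s2.
  exists (2 * n + N - 1)%N; split; first by lia.
    by rewrite /= add1n; apply: leaf_query_bound => //; apply: sp_size_gt2.
  apply: (refutable_leaf_query (w := w1) (a := - a) (b := 1 - b)) => //.
    by rewrite aE bE.
  by rewrite bE'.
- have [w2 t2E] := sp_size_le1 s2; rewrite {}t2E in v2 *.
  have [N [N2 NE r]] := IH1 _ v1 c1 s1.
  exists (2 * n + N - 1)%N; split; first by lia.
    by rewrite /= addn1; apply: leaf_query_bound => //; apply: sp_size_gt2.
  exact: (refutable_leaf_query (w := w2) (a := a) (b := b)).
- have [N1 [N1_gt2 N1E r1]] := IH1 _ v1 c1 s1.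
  have [N2 [N2_gt2 N2E r2]] := IH2 _ v2 c2 s2.
  have [s12|s21] := leqP (sp_size t1) (sp_size t2).
    exists (2 * n - 2 + c * n * N1.+1 + N2)%N; split; first by lia.
      by apply: query_bound => //; apply: sp_size_gt2.
    apply: (refutable_query (a := - a) (b := 1 - b)) => //; try lia.
    + by move=> i; rewrite mxE abszN.
    + by rewrite aE bE.
    + by rewrite bE'.
  exists (2 * n - 2 + c * n * N2.+1 + N1)%N; split; first by lia.
    rewrite [(sp_size t1 + _)%N]addnC.
    by apply: query_bound => //; [apply: sp_size_gt2|apply: ltnW].
  by apply: (refutable_query (a := a) (b := b)) => //; lia.
Qed.

(** * One variable, and the conclusion *)

(** The clauses [C] and [D] falsified by true and by false lack the positive, respectively the
    negative, literal. Either one of them is empty and its inequality is [0 <= -1], or they are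
    opposite literals whose inequalities add up to it. *)
Lemma cp_refutation_n1 (F : cnf 1) :
  cnf_unsat F -> exists pi, cp_refutation F pi /\ (size pi <= 3)%N.
Proof.
move=> unsat.
have ax C : C \in F -> clause_ineq C \in cnf_system F.
  by move=> CF; rewrite mem_cat map_f.
have clauseE (C : clause 1) : clause_ineq C =
    (const_mx ((ord0 \in C.2)%:Z - (ord0 \in C.1)%:Z), (ord0 \in C.2)%:Z - 1).
  congr pair; first by apply/rowP=> i; rewrite !mxE (ord1 i).
  by rewrite (cardsD1 ord0) (_ : C.2 :\ ord0 = finset.set0) ?cards0 ?addn0 //;
    apply/finset.setP=> i; rewrite !inE (ord1 i) eqxx.
have unit l : contradiction 1 = clause_ineq l -> l \in F ->
    exists pi, cp_refutation F pi /\ (size pi <= 3)%N.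
  move=> lE lF; exists [:: contradiction 1]; split=> //.
  split; last by rewrite inE.
  by apply: (@cp_rcons _ _ [::]); [constructor|rewrite lE; apply/cp_axiom/ax].
have /allPn[C CF] := unsat (fun=> true).
rewrite /clause_sat negb_or => /andP[/existsPn C1 _].
have {}C1 : ord0 \in C.1 = false by apply/negbTE; have := C1 ord0; rewrite andbT.
have /allPn[D DF] := unsat (fun=> false).
rewrite /clause_sat negb_or => /andP[_ /existsPn D2].
have {}D2 : ord0 \in D.2 = false by apply/negbTE; have := D2 ord0; rewrite andbT.
have CE := clauseE C; have DE := clauseE D; rewrite C1 in CE; rewrite D2 in DE.
have [C2|C2] := boolP (ord0 \in C.2); last first.
  apply: unit CF; rewrite CE (negbTE C2).
  by congr pair; apply/rowP=> i; rewrite !mxE.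
have [D1|D1] := boolP (ord0 \in D.1); last first.
  apply: unit DF; rewrite DE (negbTE D1).
  by congr pair; apply/rowP=> i; rewrite !mxE.
rewrite C2 in CE; rewrite D1 in DE.
exists [:: clause_ineq C; clause_ineq D;
  clause_ineq C *+ 1 + clause_ineq D *+ 1]; split=> //; split.
  apply: (@cp_rcons _ _ [:: _; _]); last by apply: cp_comb; rewrite !inE eqxx ?orbT.
  apply: (@cp_rcons _ _ [:: _]); last exact/cp_axiom/ax.
  by apply: (@cp_rcons _ _ [::]); [constructor|exact/cp_axiom/ax].
rewrite !inE; apply/orP; right; apply/orP; right; rewrite CE DE.
by apply/eqP; congr pair; apply/rowP=> i; rewrite !mxE.
Qed.

Theorem theorem1p2 (R : realType) (n c s : nat) (F : cnf n) (T : sp_tree R n)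
  (hn : (0 < n)%N) (hc : (0 < c)%N) (hs : (1 < s)%N)
  (hF : cnf_unsat F) (hT : sp_refutation F T)
  (hsize : sp_size T = s) (hcoef : sp_coef_le c T) :
  exists pi : seq (ineq n),
    cp_refutation F pi /\
    (size pi)%:R <= s%:R * (c * n)%:R `^ log2 (s%:R : R).
Proof.
have hs2 : (2 < s)%N by rewrite -hsize sp_size_gt2 // hsize.
have [n1|n1] := ltnP 1 n.
  rewrite -hsize in hs *.
  have [N [_ NE r]] := refutable_sp n1 hc hT hcoef hs.
  have [||pi [pf pc sz]] := r (cnf_system F).
  - by move=> l lbox; rewrite /cnf_system mem_cat lbox orbT.
  - by move=> h hS; exists h.
  exists pi; split; first by split.
  by apply: le_trans NE; rewrite ler_nat.
have {n1} n1 : n = 1%N by lia.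
subst n; have [pi [pf sz]] := cp_refutation_n1 hF.
exists pi; split=> //.
(* Three lines are enough, as [s >= 3] and the power of [c >= 1] is at least 1. *)
apply: (@le_trans _ _ (s%:R * 1)); first by rewrite mulr1 ler_nat; lia.
rewrite ler_wpM2l // -[leLHS](powRr0 ((c * 1)%:R : R)).
apply: ler_powR; first by rewrite ler1n muln1.
by rewrite divr_ge0 // ln_ge0 // ler1n //; lia.
Qed.
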